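(* Let $G$ be a compactly covered locally compact topologically quasihamiltonian group, let $\phi$ be a topological automorphism of $G$, and let $H$ be a closed normal subgroup of $G$ with $\phi(H)=H$. Then $$h_{alg}(\phi)=h_{alg}(\bar\phi)+h_{alg}(\phi\restriction_H),$$ where $\bar\phi : G/H\to G/H$ is the induced map.
   Context: All topological groups are Hausdorff. A topological group is compactly covered if each of its elements lies in a compact subgroup. A closed subgroup $N$ of a topological group $G$ is topologically quasinormal if $\overline{NL}=\overline{LN}$ for every closed subgroup $L$ of $G$; $G$ is topologically quasihamiltonian if every closed subgroup of $G$ is topologically quasinormal. A topological automorphism is a group automorphism that is also a homeomorphism. Algebraic entropy: let $G$ be a locally compact group with right Haar measure $\mu$ and $\phi$ a continuous endomorphism of $G$. For $U\subseteq G$ and $n\geq 1$ put $T_n(\phi,U)=U\cdot\phi(U)\cdots\phi^{n-1}(U)$. For $U$ a compact neighborhood of $e_G$ put $H_{alg}(\phi,U)=\limsup_{n\to\infty}\frac{\log\mu(T_n(\phi,U))}{n}$, and let $h_{alg}(\phi)\in[0,\infty]$ be the supremum of $H_{alg}(\phi,U)$ over all compact neighborhoods $U$ of $e_G$. The entropies of $\phi\restriction_H : H\to H$ and of $\bar\phi : G/H\to G/H$, $\bar\phi(gH)=\phi(g)H$, are computed in the locally compact groups $H$ and $G/H$. *)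

(* Defs.v *)
From HB Require Import structures.
From mathcomp Require Import all_boot all_order all_algebra.
From mathcomp Require Import all_classical all_reals all_analysis.

Set Implicit Arguments.
Unset Strict Implicit.
Unset Printing Implicit Defensive.

Local Open Scope classical_set_scope.
Local Open Scope group_scope.

(* Hausdorffness is not part of the structure: it is assumed of the ambient
   group by the theorems (and then follows for closed subgroups and for
   quotients by closed normal subgroups). *)
HB.mixin Record isTopologicalGroup G & Topological G & Group G := {
  mulg_continuous : continuous (fun x : G * G => x.1 * x.2) ;
  invg_continuous : continuous (fun x : G => x^-1)
}.

#[short(type="topologicalGroupType")]
HB.structure Definition TopologicalGroup :=
  {G of Topological G & Group G & isTopologicalGroup G}.

Section Subgroups.
Variable G : groupType.

Record subgroup := Subgroup {
  subgroup_set :> set G ;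
  subgroup_group_closed : group_closed (mem subgroup_set) }.

Record normal_subgroup := NormalSubgroup {
  normal_subgroup_sub :> subgroup ;
  normal_subgroupJ : forall h g : G,
    subgroup_set normal_subgroup_sub h ->
    subgroup_set normal_subgroup_sub (h ^ g) }.

End Subgroups.

Definition mul_set (G : groupType) (A B : set G) : set G :=
  [set a * b | a in A & b in B].

Section SubgroupGroup.
Variables (G : groupType) (H : subgroup G).

Definition subgroup_type : Type := set_type H.

HB.instance Definition _ := SubChoice.copy subgroup_type (set_type H).
HB.instance Definition _ :=
  SubChoice_isSubGroup.Build G _ subgroup_type (subgroup_group_closed H).

Lemma subgroup_valM :
  {morph (val : subgroup_type -> G) : x y / x * y}.
Proof. exact: valM. Qed.

Lemma subgroup_valV : {morph (val : subgroup_type -> G) : x / x^-1}.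
Proof. exact: gmulfV. Qed.

End SubgroupGroup.

Section SubgroupTopology.
Variables (G : topologicalGroupType) (H : subgroup G).

Local Notation HT := (subgroup_type H).

HB.instance Definition _ := Topological.copy HT (set_type H).

Lemma subgroup_val_continuous : continuous (val : HT -> G).
Proof. exact: initial_continuous. Qed.

Lemma subgroup_continuous (T : topologicalType) (f : T -> HT) :
  continuous (val \o f : T -> G) -> continuous f.
Proof.
move=> /continuousP cf; apply/continuousP => _ [B oB <-].
by rewrite -comp_preimage; exact: cf.
Qed.

Let mul_cont : continuous (fun x : HT * HT => x.1 * x.2).
Proof.
apply: subgroup_continuous => -[x y].
rewrite (_ : _ \o _ = (fun z : HT * HT => val z.1 * val z.2)); last first.
  by apply/funext => z /=; exact: subgroup_valM.
apply: (@continuous_comp _ _ _ (fun z : HT * HT => (val z.1, val z.2))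
  (fun z : G * G => z.1 * z.2)); last exact: mulg_continuous.
apply: cvg_pair; apply: continuous_comp;
  by [exact: cvg_fst|exact: cvg_snd|exact: subgroup_val_continuous].
Qed.

Let inv_cont : continuous (fun x : HT => x^-1).
Proof.
apply: subgroup_continuous => x.
rewrite (_ : _ \o _ = (fun z : HT => (val z)^-1)); last first.
  by apply/funext => z /=; exact: subgroup_valV.
apply: (@continuous_comp _ _ _ (val : HT -> G) (fun z : G => z^-1)).
  exact: subgroup_val_continuous.
exact: invg_continuous.
Qed.

HB.instance Definition _ := isTopologicalGroup.Build HT mul_cont inv_cont.

End SubgroupTopology.

Section QuotientGroup.
Local Open Scope quotient_scope.
Variables (G : topologicalGroupType) (N : normal_subgroup G).

(* x ~ y iff x N = y N *)
Definition coset_rel : rel G := fun x y => x^-1 * y \in (N : set G).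

Lemma normal_subgroup1 : 1 \in (N : set G).
Proof. by have [] := subgroup_group_closed N. Qed.

Lemma normal_subgroupM (x y : G) :
  x \in (N : set G) -> y \in (N : set G) -> x * y \in (N : set G).
Proof. exact: (group_closedM (subgroup_group_closed N)). Qed.

Lemma normal_subgroupV (x : G) : x \in (N : set G) -> x^-1 \in (N : set G).
Proof. exact: (group_closedV (subgroup_group_closed N)). Qed.

Lemma normal_subgroup_conj (x y : G) :
  x \in (N : set G) -> x ^ y \in (N : set G).
Proof. by rewrite !inE; exact: normal_subgroupJ. Qed.

Lemma coset_rel_refl : reflexive coset_rel.
Proof. by move=> x; rewrite /coset_rel mulVg normal_subgroup1. Qed.

Lemma coset_rel_sym : symmetric coset_rel.
Proof.
by move=> x y; apply/idP/idP => /normal_subgroupV; rewrite invgM invgK.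
Qed.

Lemma coset_rel_trans : transitive coset_rel.
Proof.
move=> y x z xy /(normal_subgroupM xy).
by rewrite /coset_rel mulgA mulgK.
Qed.

Canonical coset_equiv :=
  EquivRel coset_rel coset_rel_refl coset_rel_sym coset_rel_trans.

Definition quotient_group : Type := quotient_topology {eq_quot coset_equiv}.

Local Notation Q := quotient_group.

HB.instance Definition _ := Quotient.copy Q {eq_quot coset_equiv}.
HB.instance Definition _ :=
  Topological.copy Q (quotient_topology {eq_quot coset_equiv}).

Lemma eq_coset (x y : G) : (\pi_Q x == \pi_Q y) = (x^-1 * y \in (N : set G)).
Proof.
by apply/eqP/idP => [/(eqmodP coset_equiv)|xy] //; apply/(eqmodP coset_equiv).
Qed.

Definition quotient_mul (a b : Q) : Q := \pi_Q (repr a * repr b).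
Definition quotient_one : Q := \pi_Q 1.
Definition quotient_inv (a : Q) : Q := \pi_Q (repr a)^-1.

Lemma repr_coset (x : G) : x^-1 * repr (\pi_Q x) \in (N : set G).
Proof. by rewrite -eq_coset reprK. Qed.

Lemma quotient_mulE (x y : G) :
  quotient_mul (\pi_Q x) (\pi_Q y) = \pi_Q (x * y).
Proof.
apply/esym/eqP; rewrite eq_coset.
have := normal_subgroupM (normal_subgroup_conj y (repr_coset x)) (repr_coset y).
by rewrite /conjg invgM !mulgA mulgK.
Qed.

Lemma quotient_invE (x : G) : quotient_inv (\pi_Q x) = \pi_Q x^-1.
Proof.
apply/eqP; rewrite eq_coset invgK.
have := normal_subgroup_conj x^-1 (repr_coset x).
by rewrite /conjg invgK !mulgA mulgV mul1g.
Qed.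

Let quotP (P : Q -> Prop) : (forall x, P (\pi_Q x)) -> forall a, P a.
Proof. by move=> h a; rewrite -[a]reprK. Qed.

Let mulA : associative quotient_mul.
Proof.
elim/quotP=> x; elim/quotP=> y; elim/quotP=> z.
by rewrite !quotient_mulE mulgA.
Qed.

Let mul1 : left_id quotient_one quotient_mul.
Proof. by elim/quotP=> x; rewrite quotient_mulE mul1g. Qed.

Let mulr1 : right_id quotient_one quotient_mul.
Proof. by elim/quotP=> x; rewrite quotient_mulE mulg1. Qed.

Let mulV : left_inverse quotient_one quotient_inv quotient_mul.
Proof. by elim/quotP=> x; rewrite quotient_invE quotient_mulE mulVg. Qed.

Let mulrV : right_inverse quotient_one quotient_inv quotient_mul.
Proof. by elim/quotP=> x; rewrite quotient_invE quotient_mulE mulgV. Qed.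

HB.instance Definition _ := isGroup.Build Q mulA mul1 mulr1 mulV mulrV.

Lemma quotient_piM (x y : G) : \pi_Q (x * y) = \pi_Q x * \pi_Q y.
Proof. by rewrite -quotient_mulE. Qed.

Lemma quotient_piV (x : G) : \pi_Q x^-1 = (\pi_Q x)^-1.
Proof. by rewrite -quotient_invE. Qed.

End QuotientGroup.

Section QuotientTopology.
Local Open Scope quotient_scope.
Variables (G : topologicalGroupType) (N : normal_subgroup G).

Local Notation Q := (quotient_group N).

Lemma quotient_pi_continuous : continuous (\pi_Q : G -> Q).
Proof. exact: pi_continuous. Qed.

Lemma mulgr_continuous (g : G) : continuous (fun x : G => x * g).
Proof.
move=> x; apply: (@continuous_comp _ _ _ (fun x : G => (x, g))
  (fun z : G * G => z.1 * z.2)); last exact: mulg_continuous.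
by apply: cvg_pair; [exact: cvg_id|exact: cvg_cst].
Qed.

Lemma quotient_pi_open (U : set G) : open U -> open (\pi_Q @` U : set Q).
Proof.
move=> oU; rewrite /open /= /quotient_open.
rewrite (_ : _ @^-1` _ =
  \bigcup_(n in (N : set G)) ((fun x : G => x * n) @^-1` U)).
  apply: bigcup_open => n _.
  by move/continuousP: (@mulgr_continuous n); exact.
apply/seteqP; split=> [x [u Uu /eqP]|x [n Nn /= Uxn]].
  rewrite eq_sym eq_coset inE => Nxu.
  by exists (x^-1 * u) => //=; rewrite mulgA mulgV mul1g.
exists (x * n) => //; apply/eqP; rewrite eq_sym eq_coset.
by rewrite mulgA mulVg mul1g inE.
Qed.

Lemma quotient_pi_nbhs (x : G) (U : set G) :
  nbhs x U -> nbhs (\pi_Q x : Q) (\pi_Q @` U).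
Proof.
rewrite nbhsE => -[V [oV Vx] VU]; rewrite nbhsE.
exists (\pi_Q @` V); last exact: image_subset.
by split; [exact: quotient_pi_open|exists x].
Qed.

Let mul_cont : continuous (fun a : Q * Q => a.1 * a.2).
Proof.
move=> [a b] U; rewrite -[a]reprK -[b]reprK /= -quotient_piM.
move=> /quotient_pi_continuous /(@mulg_continuous G (repr a, repr b)).
move=> [[A B] /= [nA nB] AB].
exists (\pi_Q @` A, \pi_Q @` B) => /=.
  by split; exact: quotient_pi_nbhs.
move=> [_ _] /= [[x Ax <-] [y By <-]]; rewrite -quotient_piM.
exact: (AB (x, y)).
Qed.

Let inv_cont : continuous (fun a : Q => a^-1).
Proof.
apply/quotient_continuous => x.
rewrite (_ : _ \o _ = \pi_Q \o (fun x : G => x^-1)); last first.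
  by apply/funext => z /=; rewrite quotient_piV.
apply: continuous_comp; first exact: invg_continuous.
exact: quotient_pi_continuous.
Qed.

HB.instance Definition _ := isTopologicalGroup.Build Q mul_cont inv_cont.

End QuotientTopology.

Section Properties.
Variable G : topologicalGroupType.

Definition compactly_covered :=
  forall x : G, exists K : subgroup G, compact (K : set G) /\ (K : set G) x.

Definition topologically_quasinormal (N : subgroup G) :=
  forall L : subgroup G, closed (L : set G) ->
    closure (mul_set N L) = closure (mul_set L N).

Definition topologically_quasihamiltonian :=
  forall N : subgroup G, closed (N : set G) -> topologically_quasinormal N.

Definition topological_automorphism (phi : G -> G) :=
  {morph phi : x y / x * y} /\
  exists psi : G -> G,
    [/\ cancel phi psi, cancel psi phi, continuous phi & continuous psi].

End Properties.

Section InducedMaps.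
Local Open Scope quotient_scope.

Definition subgroup_map (G : groupType) (H : subgroup G) (phi : G -> G)
    (phiH : phi @` H = H) (x : subgroup_type H) : subgroup_type H :=
  exist _ (phi (val x))
    (mem_set (eq_ind _ (fun A : set G => A (phi (val x)))
      (imageP phi (set_mem (valP x))) _ phiH)).

Lemma subgroup_mapE (G : groupType) (H : subgroup G) (phi : G -> G)
    (phiH : phi @` H = H) (x : subgroup_type H) :
  val (subgroup_map phiH x) = phi (val x).
Proof. by []. Qed.

Definition quotient_map (G : topologicalGroupType) (N : normal_subgroup G)
    (phi : G -> G) (a : quotient_group N) : quotient_group N :=
  \pi_(quotient_group N) (phi (repr a)).

(* The choice of representatives in quotient_map is immaterial. *)
Lemma quotient_mapE (G : topologicalGroupType) (N : normal_subgroup G)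
    (phi : G -> G) :
    {morph phi : x y / x * y} -> phi @` N = N ->
  forall g : G, quotient_map phi (\pi_(quotient_group N) g) =
                \pi_(quotient_group N) (phi g).
Proof.
move=> phiM phiN g; apply/esym/eqP; rewrite eq_coset.
have phi1 : phi 1 = 1.
  by apply: (@mulgI _ (phi 1)); rewrite -phiM !mulg1.
have phiV x : phi x^-1 = (phi x)^-1.
  by apply/esym/mulg1_eq; rewrite -phiM mulgV.
rewrite -phiV -phiM inE -phiN.
by exists (g^-1 * repr (\pi_(quotient_group N) g)) => //;
  apply: set_mem; exact: repr_coset.
Qed.

End InducedMaps.

(* The library's generated sigma-algebras need a pointed carrier. *)
Definition pointed_group (G : topologicalGroupType) : Type := G.

HB.instance Definition _ (G : topologicalGroupType) :=
  Choice.copy (pointed_group G) G.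
HB.instance Definition _ (G : topologicalGroupType) :=
  isPointed.Build (pointed_group G) (1 : G).

Notation borelType G :=
  (g_sigma_algebraType (@open G : set (set (pointed_group G)))).

Section Entropy.
Variables (R : realType) (G : topologicalGroupType).
Local Open Scope ring_scope.
Local Open Scope ereal_scope.

(* A nonzero right-invariant Radon measure on the Borel sets. *)
Record right_haar_measure
    (mu : {measure set (borelType G) -> \bar R}) : Prop := RightHaarMeasure {
  right_haar_gt0 : 0 < mu [set: G] ;
  right_haar_compact : forall K : set G, compact K -> mu K < +oo ;
  right_haar_outer : forall A : set (borelType G), measurable A ->
    mu A = ereal_inf [set mu U | U in [set U : set G | open U /\ A `<=` U]] ;
  right_haar_inner : forall U : set G, open U ->
    mu U = ereal_sup [set mu K | K in [set K : set G | compact K /\ K `<=` U]] ;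
  right_haar_invariant : forall (A : set (borelType G)) (g : G),
    measurable A -> mu [set (x * g)%g | x in (A : set G)] = mu A }.

Variables (mu : {measure set (borelType G) -> \bar R}) (phi : G -> G).

(* U * phi(U) * ... * phi^(n-1)(U) *)
Fixpoint trajectory (U : set G) (n : nat) : set G :=
  if n is m.+1 then mul_set (trajectory U m) (iter m phi @` U) else [set 1%g].

(* The (irrelevant) term of index 0 is 0. *)
Definition algebraic_entropy_nbhs (U : set G) : \bar R :=
  limn_esup (fun n => (n%:R^-1)%:E * lne (mu (trajectory U n))).

Definition algebraic_entropy : \bar R :=
  ereal_sup [set algebraic_entropy_nbhs U |
    U in [set U : set G | compact U /\ nbhs (1%g : G) U]].

End Entropy.

(* Main.v *)
Require Import Defs.
From HB Require Import structures.
From mathcomp Require Import all_boot all_order all_algebra.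
From mathcomp Require Import finmap ring.
From mathcomp Require Import all_classical all_reals all_analysis.

(** The entropy of an automorphism [phi] is governed by compact open subgroups.
    Two compact subgroups commute as sets, because their product is closed, so
    finite sets lie in compact subgroups; from this every compact set is shown
    to lie in a compact open subgroup ([compact_sub_compact_open]).  Entropy is
    therefore the supremum over compact open subgroups [U].

    For such a [U] the trajectories [t n] (with n.+1 factors) are compact open
    subgroups and [t n.+1] is the product of [U] and [phi (t n)].  The subgroups
    [U `&` phi (t n)] increase inside the compact group [U], hence are constant,
    say equal to [W], from some index on.  From there the Haar measure of [t n]
    is multiplied at each step by the same number c = vol (phi U) / vol W, and
    the entropy relative to [U] is log c ([stable_volume], [stable_entropy]).

    Indices of compact open subgroups A `<=` B split along the normal subgroup:
    |B : A| = |BH/H : AH/H| |B `&` H : A `&` H| ([volume_extension]).  Applied to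
    [t n `<=` t n.+1] this factors c as the growth rate of the image of [U] in
    the quotient times vol (t n.+1 `&` H) / vol (t n `&` H).  The subgroups
    [t n `&` H] need not be trajectories of [U `&` H], but for large n the
    trajectories of [V := t n.+1 `&` H] grow exactly at that rate.  This gives
    [entropy_addition]: for every [U] there is a larger compact open subgroup
    [U'] such that the entropy relative to [U] is the sum of the entropies
    relative to the image of [U] and to [U' `&` H].

    Since entropy grows with the neighborhood and compact open subgroups form a
    directed family, which is cofinal also for the compact subsets of the
    quotient and of [H], taking suprema yields the theorem. *)

Set Implicit Arguments.
Unset Strict Implicit.
Unset Printing Implicit Defensive.

Import Order.TTheory GRing.Theory Num.Theory.
Import numFieldNormedType.Exports.

Local Open Scope classical_set_scope.
Local Open Scope group_scope.

(** * Products and images of subgroups *)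

Section Subsets.
Variable G : groupType.
Implicit Types A B C : set G.

Definition is_subgroup A :=
  [/\ A 1, (forall x y, A x -> A y -> A (x * y)) & (forall x, A x -> A x^-1)].

Lemma subgroup_is_subgroup (K : subgroup G) : is_subgroup K.
Proof.
have [K1 _] := subgroup_group_closed K; split; first exact: set_mem.
- move=> x y /mem_set Kx /mem_set Ky; apply: set_mem.
  exact: (group_closedM (subgroup_group_closed K)).
- move=> x /mem_set Kx; apply: set_mem.
  exact: (group_closedV (subgroup_group_closed K)).
Qed.

Lemma is_subgroup_subgroup A : is_subgroup A ->
  exists K : subgroup G, K = A :> set G.
Proof.
move=> [A1 AM AV]; have gA : group_closed (mem A).
  split; first exact: mem_set.
  by move=> x y /set_mem Ax /set_mem Ay; apply: mem_set; apply/AM/AV.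
by exists (Subgroup gA).
Qed.

Lemma is_subgroupI A B : is_subgroup A -> is_subgroup B -> is_subgroup (A `&` B).
Proof.
move=> [A1 AM AV] [B1 BM BV]; split=> //.
- by move=> x y [? ?] [? ?]; split; [apply: (AM)|apply: (BM)].
- by move=> x [? ?]; split; [apply: (AV)|apply: (BV)].
Qed.

Lemma mul_setA : associative (@mul_set G).
Proof.
move=> A B C; apply/seteqP; split=> [_ [a Aa [_ [b Bb [c Cc <-]] <-]]|].
  by exists (a * b); [exists a => //; exists b|exists c => //; rewrite mulgA].
move=> _ [_ [a Aa [b Bb <-]] [c Cc <-]].
by exists a => //; exists (b * c); [exists b => //; exists c|rewrite mulgA].
Qed.

Lemma mul_setS {A B C D : set G} : A `<=` C -> B `<=` D ->
  mul_set A B `<=` mul_set C D.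
Proof. by move=> AC BD _ [a /AC Ca [b /BD Db <-]]; exists a => //; exists b. Qed.

Lemma mul_set_subl A B : B 1 -> A `<=` mul_set A B.
Proof. by move=> B1 a Aa; exists a => //; exists 1 => //; rewrite mulg1. Qed.

Lemma mul_set_subr A B : A 1 -> B `<=` mul_set A B.
Proof. by move=> A1 b Bb; exists 1 => //; exists b => //; rewrite mul1g. Qed.

Lemma mul_set1l A : mul_set [set 1] A = A.
Proof.
apply/seteqP; split; last exact: mul_set_subr.
by move=> _ [_ -> [a Aa <-]]; rewrite mul1g.
Qed.

Lemma mul_set1r A : mul_set A [set 1] = A.
Proof.
apply/seteqP; split; last exact: mul_set_subl.
by move=> _ [a Aa [_ -> <-]]; rewrite mulg1.
Qed.

Lemma is_subgroup_mulC A B : is_subgroup A -> is_subgroup B ->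
  is_subgroup (mul_set A B) -> mul_set A B = mul_set B A.
Proof.
move=> [A1 AM AV] [B1 BM BV] [_ CM CV]; apply/seteqP; split=> [x Cx|].
  have [a Aa [b Bb /(congr1 (fun y => y^-1))]] := CV x Cx.
  rewrite invgM invgK => <-; exists b^-1; first exact: (BV).
  by exists a^-1 => //; exact: (AV).
move=> _ [b Bb [a Aa <-]]; apply: (CM); first exact: mul_set_subr.
exact: mul_set_subl.
Qed.

Lemma is_subgroup_mul A B : is_subgroup A -> is_subgroup B ->
  mul_set A B = mul_set B A -> is_subgroup (mul_set A B).
Proof.
move=> [A1 AM AV] [B1 BM BV] AB; split; first exact: mul_set_subl.
- move=> _ _ [a Aa [b Bb <-]] [c Ac [d Bd <-]].
  have : mul_set A B (b * c) by rewrite AB; exists b => //; exists c.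
  move=> [c' Ac' [b' Bb' cb]]; exists (a * c'); first exact: (AM).
  exists (b' * d); first exact: (BM).
  by rewrite mulgA -(mulgA a) cb !mulgA.
- move=> _ [a Aa [b Bb <-]]; rewrite invgM AB; exists b^-1; first exact: (BV).
  by exists a^-1 => //; apply: (AV).
Qed.

End Subsets.

Section Morphisms.
Variables (G G' : groupType) (f : G -> G').
Hypothesis fM : {morph f : x y / x * y}.

Lemma morph1 : f 1 = 1.
Proof. by apply: (@mulgI _ (f 1)); rewrite -fM !mulg1. Qed.

Lemma morphV : {morph f : x / x^-1}.
Proof. by move=> x; apply/esym/mulg1_eq; rewrite -fM mulgV morph1. Qed.

Lemma is_subgroup_image (A : set G) : is_subgroup A -> is_subgroup (f @` A).
Proof.
move=> [A1 AM AV]; split; first by exists 1; rewrite ?morph1.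
- by move=> _ _ [x Ax <-] [y Ay <-]; exists (x * y); [exact: (AM)|rewrite fM].
- by move=> _ [x Ax <-]; exists x^-1; [exact: (AV)|rewrite morphV].
Qed.

Lemma is_subgroup_preimage (A : set G') : is_subgroup A -> is_subgroup (f @^-1` A).
Proof.
move=> [A1 AM AV]; split; first by rewrite /= morph1.
- by move=> x y /= Ax Ay; rewrite fM; exact: (AM).
- by move=> x /= Ax; rewrite morphV; exact: (AV).
Qed.

Lemma image_mul_set (A B : set G) : f @` mul_set A B = mul_set (f @` A) (f @` B).
Proof.
apply/seteqP; split=> [_ [_ [a Aa [b Bb <-]] <-]|].
  by exists (f a); [exists a|exists (f b); [exists b|rewrite fM]].
move=> _ [_ [a Aa <-] [_ [b Bb <-] <-]].
by exists (a * b); [exists a => //; exists b|rewrite fM].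
Qed.

End Morphisms.

(** * Coset transversals *)

Section Transversal.
Variable G : groupType.
Implicit Types A B N : set G.

(** When [A] is not contained in [B] this is a transversal of [A `&` B] in [B];
    allowing such [A] makes the second isomorphism theorem the mere remark that
    [r] serves [mul_set A B] as well as it serves [B].  Indexing by an arbitrary
    finite type lets transversals be multiplied along a tower of subgroups. *)
Definition right_transversal (I : finType) A B (r : I -> G) :=
  (forall i, B (r i)) /\ (forall b, B b -> exists! i, A (b * (r i)^-1)).

(** Together with [right_transversal_mul] this is the second isomorphism theorem
    |AB : A| = |B : A `&` B|, in the form of a common transversal. *)
Lemma right_transversalI {I : finType} {A B} {r : I -> G} : is_subgroup B ->
  right_transversal A B r -> right_transversal (A `&` B) B r.
Proof.
move=> [B1 BM BV] [Br Ar]; split=> // b Bb; have [i [Ai ui]] := Ar b Bb.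
exists i; split=> [|j [/ui]//]; split=> //; apply: (BM) => //; exact: (BV).
Qed.

Lemma right_transversal_mul {I : finType} {A B} {r : I -> G} : is_subgroup A ->
  right_transversal A B r -> right_transversal A (mul_set A B) r.
Proof.
move=> [A1 AM AV] [Br Ar]; split=> [i|_ [a Aa [b Bb <-]]].
  exact: mul_set_subr.
have [i [Ai ui]] := Ar b Bb; exists i; split=> [|j Aj].
  by rewrite -mulgA; exact: (AM).
apply: ui; rewrite (_ : b * _ = a^-1 * (a * b * (r j)^-1)).
  by apply: (AM) => //; exact: (AV).
by rewrite -!mulgA mulKg.
Qed.

(** The index splits along a subgroup [N]:
    |B : A| = |BN : AN| |B `&` N : A `&` N|.
    If [b] is in the coset [A n r_i] then [n] is in [B `&` N], because
    [A `<=` B], and the coset of [n] modulo [A] gives the second index. *)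
Lemma right_transversal_extension {I J : finType} {A B N} {r : I -> G} {s : J -> G} :
  is_subgroup A -> is_subgroup B -> is_subgroup N -> A `<=` B ->
  right_transversal (mul_set A N) B r -> right_transversal A (B `&` N) s ->
  right_transversal A B (fun ij : I * J => s ij.2 * r ij.1).
Proof.
move=> [A1 AM AV] [B1 BM BV] [N1 NM NV] AB [Br Ar] [BNs As]; split.
  by move=> [i j] /=; apply: (BM) => //; have [] := BNs j.
move=> b Bb; have [i [[a Aa [n Nn an]] ui]] := Ar b Bb.
have nE : n = a^-1 * (b * (r i)^-1) by rewrite -an mulKg.
have Bn : B n.
  by rewrite nE; apply: (BM); [exact/BV/AB|apply: (BM) => //; exact/BV/Br].
have [j [Aj uj]] := As n (conj Bn Nn).
have shift k : b * (s k * r i)^-1 = a * (n * (s k)^-1).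
  by rewrite invgM !mulgA -an.
exists (i, j); split=> /= [|[i' j'] /= Aij]; first by rewrite shift; exact: (AM).
have ii' : i = i'.
  apply: ui; exists (b * (s j' * r i')^-1) => //; exists (s j').
    by have [] := BNs j'.
  by rewrite invgM !mulgA mulgVK.
rewrite -ii' in Aij *; congr pair; apply: uj.
by have := AM _ _ (AV _ Aa) Aij; rewrite shift mulKg.
Qed.

End Transversal.

(** Covers three uses: an injective [f] (automorphisms and inclusions), where
    [f @^-1` (f @` A) = A], and the projection to a quotient, where the preimage
    of the image of [A] is [mul_set A N]. *)
Lemma right_transversal_image (G G' : groupType) (f : G -> G') (I : finType)
    (A : set G') (B : set G) (r : I -> G) : {morph f : x y / x * y} ->
  right_transversal (f @^-1` A) B r -> right_transversal A (f @` B) (f \o r).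
Proof.
move=> fM [Br Ar]; split=> [i|_ [b Bb <-]]; first exact: imageP.
have [i [Ai ui]] := Ar b Bb; exists i; split=> [|j /= Aj].
  by rewrite /= -(morphV fM) -fM.
by apply: ui; rewrite /= fM (morphV fM).
Qed.

(** * Open and compact subgroups *)

Section TopologicalGroup.
Variable G : topologicalGroupType.
Implicit Types A B K L : set G.

Lemma image_translate A (g : G) :
  (fun x => x * g) @` A = (fun x => x * g^-1) @^-1` A.
Proof.
apply/seteqP; split=> [_ [a Aa <-]|x /= Ax]; first by rewrite /= mulgK.
by exists (x * g^-1) => //; rewrite mulgVK.
Qed.

Lemma open_translate A (g : G) : open A -> open ((fun x => x * g) @` A).
Proof.
rewrite image_translate => oA.
by move/continuousP: (@mulgr_continuous G g^-1); exact.
Qed.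

Lemma mul_set_bigcup A B :
  mul_set A B = \bigcup_(b in B) ((fun x => x * b) @` A).
Proof.
apply/seteqP; split=> [_ [a Aa [b Bb <-]]|_ [b Bb [a Aa <-]]].
  by exists b => //; exists a.
by exists a => //; exists b.
Qed.

Lemma open_mul_set A B : open A -> open (mul_set A B).
Proof.
by move=> oA; rewrite mul_set_bigcup; apply: bigcup_open => b _; exact: open_translate.
Qed.

Lemma continuous_compact_image (T T' : topologicalType) (f : T -> T')
  (A : set T) : continuous f -> compact A -> compact (f @` A).
Proof.
by move=> cf cA; apply: continuous_compact => //; exact: continuous_subspaceT.
Qed.

Lemma compact_mul_set A B : compact A -> compact B -> compact (mul_set A B).
Proof.
move=> cA cB; rewrite (_ : mul_set A B = (fun x : G * G => x.1 * x.2) @` (A `*` B)).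
  apply: continuous_compact_image; last exact: compact_setX.
  exact: mulg_continuous.
apply/seteqP; split=> [_ [a Aa [b Bb <-]]|_ [[a b] /= [Aa Bb] <-]].
  by exists (a, b).
by exists a => //; exists b.
Qed.

Lemma open_subgroup_nbhs A U : is_subgroup A -> nbhs (1 : G) U -> U `<=` A ->
  open A.
Proof.
move=> [A1 AM AV] nU UA; rewrite openE => a Aa; rewrite /interior.
have : nbhs (a * a^-1) U by rewrite mulgV.
move=> /(@mulgr_continuous G a^-1 a) naU.
apply: (@filterS _ (nbhs a) _ ((fun x => x * a^-1) @^-1` U)) naU => x /= /UA Ax.
by rewrite -(mulgVK a x); exact: (AM).
Qed.

Lemma open_subgroup_closed A : is_subgroup A -> open A -> closed A.
Proof.
move=> [A1 AM AV] oA; rewrite -[A]setCK; apply: open_closedC.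
rewrite (_ : ~` A = \bigcup_(x in ~` A) ((fun y => y * x) @` A)).
  by apply: bigcup_open => x _; exact: open_translate.
apply/seteqP; split=> [x nAx|_ [x nAx [a Aa <-]] Aax].
  by exists x => //; exists 1 => //; rewrite mul1g.
apply: nAx; rewrite -(mulKg a x); apply: (AM) => //; exact: (AV).
Qed.

(** The form in which compactness is used throughout: a compact set is covered
    by finitely many right translates of an open neighborhood of 1. *)
Lemma compact_translates K U : compact K -> open U -> U 1 ->
  exists D : {fset G}, [set` D] `<=` K /\ K `<=` mul_set U [set` D].
Proof.
move=> cK oU U1.
pose pG : ptopologicalType := HB.pack (G : Type) G (isPointed.Build G 1).
have : @cover_compact pG K by rewrite -(@compact_cover pG).
move=> /(_ G K (fun x => (fun y => y * x) @` U)).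
case.
- by move=> x _; exact: open_translate.
- by move=> x Kx; exists x => //; exists 1 => //; rewrite mul1g.
move=> D DK KD; exists D; split; first by move=> x /DK /set_mem.
by rewrite mul_set_bigcup.
Qed.

Lemma locally_compact_nbhs1 : locally_compact [set: G] ->
  exists2 W, nbhs (1 : G) W & compact W.
Proof.
move=> lcG; have [W /= W1 [cW _]] := lcG (1 : G) I; exists W => //.
by apply: (@filterS _ (nbhs (1 : G)) _ [set x | [set: G] x -> W x]) W1 => x; apply.
Qed.

(** The representative of [b] is chosen as a function of the set of all
    elements of [B] in its coset, so that it only depends on the coset;
    finitely many cosets meet [B] because they are open. *)
Lemma transversal_exists A B : is_subgroup A -> open A -> compact B ->
  exists (I : finType) (r : I -> G), right_transversal A B r.
Proof.
move=> [A1 AM AV] oA cB.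
(* the default value 1 is never taken for b in B *)
pose r b := xget 1 [set x | B x /\ A (b * x^-1)].
have rP b : B b -> B (r b) /\ A (b * (r b)^-1).
  move=> Bb; have bB : [set x | B x /\ A (b * x^-1)] b by rewrite /= mulgV.
  exact: (xgetI 1 bB).
have rE b c : A (b * c^-1) -> r b = r c.
  move=> Abc; congr xget; apply/seteqP; split=> x /= [Bx Ax]; split=> //.
    by have := AM _ _ (AV _ Abc) Ax; rewrite invgM invgK mulgA mulgVK.
  by have := AM _ _ Abc Ax; rewrite mulgA mulgVK.
have [D [DB BD]] := compact_translates cB oA A1.
pose X := [fset r d | d in D]%fset.
exists X, (fun x => fsval x); split=> [[x Xx] /=|b Bb].
  by have /imfsetP [d /= Dd ->] := Xx; have [] := rP d (DB d Dd).
have [a Aa [d Dd ad]] := BD b Bb.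
have rbd : r b = r d.
  by apply: rE; rewrite -ad mulgK.
have Xrb : r b \in X by rewrite rbd; apply/imfsetP; exists d.
have [Brb Arb] := rP b Bb.
exists [` Xrb]%fset; split=> [//|[x Xx] /= Ax]; apply: val_inj => /=.
have /imfsetP [e /= De xe] := Xx.
have Be : B e by exact: DB.
have [Bre Are] := rP e Be.
rewrite xe; apply: rE.
by have := AM _ _ Ax (AV _ Are); rewrite xe invgM invgK mulgA mulgVK.
Qed.

End TopologicalGroup.

(** * Haar measure of compact open subgroups *)

Definition compact_open_subgroup (G : topologicalGroupType) (A : set G) :=
  [/\ is_subgroup A, open A & compact A].

Section HaarMeasure.
Local Open Scope ring_scope.
Local Open Scope ereal_scope.
Variables (R : realType) (G : topologicalGroupType).
Variable mu : {measure set (borelType G) -> \bar R}.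
Hypotheses (hausG : hausdorff_space G) (haar : right_haar_measure mu).

Lemma open_borel (U : set G) : open U -> measurable (U : set (borelType G)).
Proof. by move=> oU; exact: sub_sigma_algebra. Qed.

Lemma compact_borel (K : set G) : compact K -> measurable (K : set (borelType G)).
Proof.
move=> cK; rewrite -[K]setCK; apply: measurableC; apply: open_borel.
by apply: closed_openC; exact: compact_closed.
Qed.

(** Were [A] null, every compact set, being covered by finitely many translates
    of [A], would be null, hence the whole group by inner regularity. *)
Lemma haar_gt0 (A : set G) : open A -> A 1%g -> 0 < mu A.
Proof.
move=> oA A1; rewrite lt0e measure_ge0 andbT; apply/eqP => muA0.
have := right_haar_gt0 haar; rewrite (right_haar_inner haar openT) ltNge.
move=> /negP; apply; apply: ge_ereal_sup => _ [K [cK _] <-].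
have [D [_ KD]] := compact_translates cK oA A1.
rewrite mul_set_bigcup in KD.
apply: (le_trans (content_sub_fsum (D := [set` D])
  (A_ := fun x => (fun y => (y * x)%g) @` A) mu _ _ _ KD)).
- exact: finite_fset.
- by move=> i _; apply: open_borel; exact: open_translate.
- exact: compact_borel.
rewrite fsbig1 // => x _.
exact: etrans (right_haar_invariant haar x (open_borel oA)) muA0.
Qed.

(** A real number, meaningful on compact open subgroups by [volumeE], so that
    quotients of measures can be formed in a field. *)
Definition volume (A : set G) : R := fine (mu A).

Lemma volumeE A : compact_open_subgroup A -> mu A = (volume A)%:E.
Proof.
move=> [_ oA cA]; rewrite fineK // ge0_fin_numE ?measure_ge0 //.
exact: right_haar_compact haar _ cA.
Qed.

Lemma volume_gt0 A : compact_open_subgroup A -> (0 < volume A)%R.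
Proof.
move=> coA; rewrite -lte_fin -volumeE //; have [[A1 _ _] oA _] := coA.
exact: haar_gt0.
Qed.

Lemma haar_transversal (I : finType) (A B : set G) (r : I -> G) :
  is_subgroup B -> open A -> A `<=` B -> right_transversal A B r ->
  mu B = #|I|%:R%:E * mu A.
Proof.
move=> [B1 BM BV] oA AB [Br Ar].
have -> : B = \bigcup_(i in [set: I]) ((fun y => (y * r i)%g) @` A).
  apply/seteqP; split=> [b Bb|_ [i _ [a Aa <-]]]; last exact: BM (AB _ Aa) (Br i).
  have [i [Ai _]] := Ar b Bb; exists i => //; exists (b * (r i)^-1)%g => //.
  by rewrite mulgVK.
rewrite measure_fin_bigcup.
- rewrite (@fsbigE _ _ _ _ _ (index_enum I)) //=.
  + rewrite (eq_bigl (mem I)) => [|i]; last exact: mem_set.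
    rewrite (eq_bigr (fun=> mu A)) => [|i _].
      by rewrite sumr_const mule_natl.
    exact: (right_haar_invariant haar (r i) (open_borel oA)).
  + by rewrite /index_enum -enumT enum_uniq.
  + by move=> i _; rewrite mem_index_enum.
- exact: finite_finset.
- move=> i j _ _ [x [[a Aa <-] [b Ab ab]]].
  have [k [_ uk]] := Ar (a * r i)%g (BM _ _ (AB _ Aa) (Br i)).
  have <- : k = i by apply: uk; rewrite mulgK.
  by apply: uk; rewrite -ab mulgK.
- by move=> i _; apply: open_borel; exact: open_translate.
Qed.

Lemma volume_transversal (I : finType) (A B : set G) (r : I -> G) :
  compact_open_subgroup A -> compact_open_subgroup B -> A `<=` B ->
  right_transversal A B r -> volume B = (#|I|%:R * volume A)%R.
Proof.
move=> coA coB AB tr; have [_ oA _] := coA; have [sB _ _] := coB.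
by have := haar_transversal sB oA AB tr; rewrite !volumeE // -EFinM => -[].
Qed.

End HaarMeasure.

Section Limit.
Local Open Scope ring_scope.
Variable R : realType.

Lemma cvg_ln_geometric (v : nat -> R) (c : R) N : (0 < N)%N -> 0 < c ->
  0 < v N -> (forall n, (N <= n)%N -> v n.+1 = c * v n) ->
  (fun n => n%:R^-1 * ln (v n)) @ \oo --> ln c.
Proof.
move=> N0 c0 vN0 vS.
have vE k : v (k + N)%N = c ^+ k * v N.
  elim: k => [|k IH]; first by rewrite expr0 mul1r.
  by rewrite addSn vS ?leq_addl // IH exprS mulrA.
rewrite -(@cvg_shiftn N).
have -> : [sequence (n + N)%:R^-1 * ln (v (n + N)%N)]_n =
    (fun n => ln c + (n + N)%:R^-1 * (ln (v N) - N%:R * ln c)).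
  apply/funext => n /=; rewrite vE lnM ?posrE ?exprn_gt0 // lnXn //.
  have nN : (n + N)%:R != 0 :> R by rewrite pnatr_eq0 addn_eq0 negb_and -!lt0n N0 orbT.
  rewrite -[ln c *+ n]mulr_natl; apply: (mulfI nN).
  by rewrite mulVKf // mulrDr mulVKf // natrD mulrDl; ring.
set C := ln (v N) - _.
suff : (fun n => (n + N)%:R^-1 : R) @ \oo --> (0 : R).
  move=> inv0; have := cvgD (cvg_cst (ln c)) (cvgM inv0 (cvg_cst C)).
  by rewrite mul0r addr0; apply.
have := @cvg_harmonic R; rewrite -(@cvg_shiftn N.-1) /=.
by under eq_fun do rewrite -addnS prednK //.
Qed.

End Limit.

(** * Compact subgroups of a topologically quasihamiltonian group *)

Definition compact_subgroup (G : topologicalGroupType) (A : set G) :=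
  is_subgroup A /\ compact A.

Section CompactSubgroups.
Variable G : topologicalGroupType.
Hypotheses (hausG : hausdorff_space G) (lcG : locally_compact [set: G]).
Hypotheses (ccG : compactly_covered G) (tqhG : topologically_quasihamiltonian G).

(** A product of two compact sets is compact, hence closed, so that
    quasinormality holds without taking closures. *)
Lemma compact_subgroup_mulC (A B : set G) :
  compact_subgroup A -> compact_subgroup B -> mul_set A B = mul_set B A.
Proof.
move=> [sA cA] [sB cB].
have [K KA] := is_subgroup_subgroup sA; have [L LB] := is_subgroup_subgroup sB.
rewrite -KA -LB; have cl (C D : set G) : compact C -> compact D -> closed (mul_set C D).
  by move=> cC cD; apply: compact_closed => //; exact: compact_mul_set.
have cK : compact K by rewrite KA.
have cL : compact L by rewrite LB.
have := tqhG (compact_closed hausG cK) (compact_closed hausG cL).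
by rewrite -!(closure_id _).1 //; exact: cl.
Qed.

Lemma compact_subgroup_mul (A B : set G) :
  compact_subgroup A -> compact_subgroup B -> compact_subgroup (mul_set A B).
Proof.
move=> csA csB; have [[sA cA] [sB cB]] := (csA, csB); split.
  by apply: is_subgroup_mul => //; exact: compact_subgroup_mulC.
exact: compact_mul_set.
Qed.

Lemma compact_subgroup_seq (s : seq G) :
  exists2 K, compact_subgroup K & forall x, x \in s -> K x.
Proof.
elim: s => [|x s [K csK Ks]].
  have [K [cK K1]] := ccG 1; exists K => //.
  by split=> //; exact: subgroup_is_subgroup.
have [L [cL Lx]] := ccG x.
have csL : compact_subgroup L by split=> //; exact: subgroup_is_subgroup.
exists (mul_set L K); first exact: compact_subgroup_mul.
have [[[L1 _ _] _] [[K1 _ _] _]] := (csL, csK).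
move=> y; rewrite inE => /orP[/eqP ->|/Ks]; first exact: mul_set_subl.
exact: mul_set_subr.
Qed.

(** Enlarge [C] to a compact symmetric neighborhood [S] of 1.  As [mul_set S S]
    is compact, it lies in [mul_set S D] for a finite set [D], and [D] lies in a
    compact subgroup [K].  Then [M := mul_set S K] is compact and stable under
    left multiplication by [S], so the elements whose left translation preserves
    [M] form a subgroup that contains [S] (hence is open) and lies in [M] (hence
    is compact). *)
Lemma compact_sub_compact_open (C : set G) : compact C ->
  exists2 A, compact_open_subgroup A & C `<=` A.
Proof.
move=> cC; have [W nW cW] := locally_compact_nbhs1 lcG.
pose S := (C `|` W) `|` (fun x => x^-1) @` (C `|` W).
have cS : compact S.
  have cCW := compactU cC cW; apply: compactU => //.
  by apply: continuous_compact_image => //; exact: invg_continuous.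
have SV x : S x -> S x^-1.
  by case=> [CWx|[y CWy <-]]; [right; exists x|left; rewrite invgK].
have nS : nbhs (1 : G) S by apply: filterS nW => x Wx; left; right.
have [D [_ SSD]] := compact_translates (compact_mul_set cS cS)
  (@open_interior _ S) nS.
have [K [[K1 KM KV] cK] DK] := compact_subgroup_seq (enum_fset D).
pose M := mul_set S K.
have SM x y : S x -> M y -> M (x * y).
  move=> Sx [z Sz [k Kk <-]].
  have [u /interior_subset Su [d Dd xz]] : mul_set S^° [set` D] (x * z).
    by apply: SSD; exists x => //; exists z.
  by exists u => //; exists (d * k); [apply: KM => //; exact: DK|rewrite mulgA xz mulgA].
have S1 : S 1 := nbhs_singleton nS.
have M1 : M 1 by exists 1 => //; exists 1 => //; rewrite mulg1.
pose A := [set x | forall y, M y -> M (x * y) /\ M (x^-1 * y)].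
have sA : is_subgroup A; first split.
- by move=> y My; rewrite invg1 mul1g.
- move=> x y Ax Ay z Mz; rewrite invgM -!mulgA; split.
    by have [/Ax[]] := Ay _ Mz.
  by have [_ /Ay[]] := Ax _ Mz.
- by move=> x Ax y /Ax[? ?]; rewrite invgK.
have SA : S `<=` A by move=> x Sx y My; split; apply: SM => //; exact: SV.
have oA := open_subgroup_nbhs sA nS SA.
exists A; last by move=> x Cx; apply: SA; left; left.
split=> //; apply: (@subclosed_compact _ _ M) => //.
- exact: open_subgroup_closed.
- exact: compact_mul_set.
- by move=> x /(_ _ M1) []; rewrite mulg1.
Qed.

End CompactSubgroups.

(** * Trajectories *)

Section Trajectories.
Variables (G : topologicalGroupType) (phi : G -> G).
Hypothesis phiM : {morph phi : x y / x * y}.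
Implicit Types (U V : set G) (n : nat).

Lemma iter_morph n : {morph iter n phi : x y / x * y}.
Proof. by elim: n => [|n IH] x y //=; rewrite IH phiM. Qed.

(** The definition adds factors on the right; adding them on the left relates
    the step of index n to the image under [phi] of the previous trajectory. *)
Lemma trajectorySl U n :
  trajectory phi U n.+1 = mul_set U (phi @` trajectory phi U n).
Proof.
elim: n => [|n IH].
  by rewrite /= mul_set1l image_set1 (morph1 phiM) mul_set1r image_id.
have -> : trajectory phi U n.+2 =
  mul_set (trajectory phi U n.+1) (iter n.+1 phi @` U) by [].
by rewrite [in LHS]IH -mul_setA [in RHS]/= (image_mul_set phiM) image_comp.
Qed.

Lemma trajectory1 U : trajectory phi U 1 = U.
Proof. by rewrite /= mul_set1l image_id. Qed.

Lemma trajectory_subS U n : U 1 -> trajectory phi U n `<=` trajectory phi U n.+1.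
Proof.
move=> U1; apply: mul_set_subl; exists 1 => //; exact: (morph1 (iter_morph n)).
Qed.

Lemma trajectory_le U m n : U 1 -> (m <= n)%N ->
  trajectory phi U m `<=` trajectory phi U n.
Proof.
move=> U1 /subnKC <-; elim: (n - m)%N => [|k IH]; first by rewrite addn0.
by rewrite addnS; apply: subset_trans IH _; exact: trajectory_subS.
Qed.

Lemma trajectoryS U V n : U `<=` V -> trajectory phi U n `<=` trajectory phi V n.
Proof.
by move=> UV; elim: n => //= n IH; apply: mul_setS => //; exact: image_subset.
Qed.

Lemma image_trajectory_sub U n : U 1 ->
  phi @` trajectory phi U n `<=` trajectory phi U n.+1.
Proof. by move=> U1; rewrite trajectorySl; exact: mul_set_subr. Qed.

Lemma iter_continuous n : continuous phi -> continuous (iter n phi).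
Proof.
move=> cphi; elim: n => [|n IH] x /=; first exact: cvg_id.
by apply: (@continuous_comp _ _ _ (iter n phi) phi); [exact: IH|exact: cphi].
Qed.

Lemma compact_trajectory U n : continuous phi -> compact U ->
  compact (trajectory phi U n).
Proof.
move=> cphi cU; elim: n => [|n IH]; first exact: compact_set1.
apply: compact_mul_set => //; apply: continuous_compact_image => //.
exact: iter_continuous.
Qed.

Lemma trajectory_compact_subgroup U n : hausdorff_space G ->
    topologically_quasihamiltonian G -> continuous phi ->
  compact_subgroup U -> compact_subgroup (trajectory phi U n).
Proof.
move=> hausG tqhG cphi [sU cU]; elim: n => [|n IH] /=.
  split; last exact: compact_set1.
  split=> //; first by move=> _ _ -> ->; rewrite mulg1.
  by move=> _ ->; rewrite invg1.
apply: compact_subgroup_mul => //; split.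
  exact: is_subgroup_image (iter_morph n) _ sU.
by apply: continuous_compact_image => //; exact: iter_continuous.
Qed.

End Trajectories.

Lemma image_trajectory (G G' : topologicalGroupType) (phi : G -> G)
    (phi' : G' -> G') (f : G -> G') (U : set G) n :
  {morph f : x y / x * y} -> (forall x, f (phi x) = phi' (f x)) ->
  f @` trajectory phi U n = trajectory phi' (f @` U) n.
Proof.
move=> fM fphi; elim: n => [|n IH] /=; first by rewrite image_set1 (morph1 fM).
rewrite (image_mul_set fM) IH !image_comp; congr (mul_set _ (_ @` _)).
by apply/funext => x /=; elim: n {IH} => //= n <-; rewrite fphi.
Qed.

(** * Entropy relative to a compact open subgroup *)

(** The union [V] of the chain is an open, hence closed, subgroup of the
    compact set [U]; finitely many translates of [W 0] cover it, and the finitely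
    many translating elements all lie in one term of the chain. *)
Lemma compact_increasing_stable (G : topologicalGroupType) (U : set G)
    (W : nat -> set G) :
  compact U -> (forall n, is_subgroup (W n)) -> (forall n, open (W n)) ->
  (forall m n, (m <= n)%N -> W m `<=` W n) -> (forall n, W n `<=` U) ->
  exists n0, forall n, (n0 <= n)%N -> W n = W n0.
Proof.
move=> cU sW oW Wle WU; pose V := \bigcup_n W n.
have sV : is_subgroup V.
  split; first by exists 0%N => //; have [] := sW 0%N.
    move=> x y [m _ Wx] [n _ Wy]; exists (maxn m n) => //.
    have [_ WM _] := sW (maxn m n); apply: WM.
      exact: Wle (leq_maxl _ _) _ Wx.
    exact: Wle (leq_maxr _ _) _ Wy.
  by move=> x [n _ Wx]; exists n => //; have [_ _ WV] := sW n; exact: WV.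
have oV : open V by apply: bigcup_open => n _; exact: oW.
have cV : compact V.
  apply: (subclosed_compact _ cU); first exact: open_subgroup_closed.
  by move=> x [n _]; exact: WU.
have [W01 _ _] := sW 0%N.
have [D [DV VD]] := compact_translates cV (oW 0%N) W01.
have [N ND] : exists N, forall d, d \in enum_fset D -> W N d.
  have : forall d, d \in enum_fset D -> V d by move=> d; exact: DV.
  elim: (enum_fset D) => [|d s IH] sV'; first by exists 0%N.
  have [|N sN] := IH; first by move=> e es; apply: sV'; rewrite inE es orbT.
  have [n _ Wd] := sV' d (mem_head _ _); exists (maxn n N) => e.
  rewrite inE => /orP[/eqP ->|/sN We]; first exact: Wle (leq_maxl _ _) _ Wd.
  exact: Wle (leq_maxr _ _) _ We.
exists N => n Nn; apply/seteqP; split; last exact: Wle.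
move=> x Wx; have [y Wy [d Dd <-]] : mul_set (W 0%N) [set` D] x.
  by apply: VD; exists n.
have [_ WM _] := sW N; apply: WM; last exact: ND.
exact: Wle (leq0n N) _ Wy.
Qed.

Section Automorphisms.
Variables (G : topologicalGroupType) (phi : G -> G).
Hypothesis phi_aut : topological_automorphism phi.

Lemma automorphism_image_open (A : set G) : open A -> open (phi @` A).
Proof.
have [_ [psi [phiK psiK _ cpsi]]] := phi_aut => oA.
rewrite (_ : phi @` A = psi @^-1` A); first by move/continuousP: cpsi; exact.
apply/seteqP; split=> [_ [x Ax <-]|x /= Ax]; first by rewrite /= phiK.
by exists (psi x).
Qed.

Lemma automorphism_compact_open (A : set G) :
  compact_open_subgroup A -> compact_open_subgroup (phi @` A).
Proof.
move=> [sA oA cA]; have [phiM [_ [_ _ cphi _]]] := phi_aut; split.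
- exact: is_subgroup_image.
- exact: automorphism_image_open.
- exact: continuous_compact_image.
Qed.

Lemma trajectory_compact_open (U : set G) n : compact_open_subgroup U ->
  is_subgroup (trajectory phi U n.+1) ->
  compact_open_subgroup (trajectory phi U n.+1).
Proof.
move=> [_ oU cU] sT; have [phiM [_ [_ _ cphi _]]] := phi_aut; split=> //.
  by rewrite trajectorySl //; exact: open_mul_set.
exact: compact_trajectory.
Qed.

End Automorphisms.

Lemma compact_open_subgroupI (G : topologicalGroupType) (A B : set G) :
  compact_open_subgroup A -> compact_open_subgroup B ->
  compact_open_subgroup (A `&` B).
Proof.
move=> [sA oA cA] [sB oB cB]; split; [exact: is_subgroupI|exact: openI|].
by apply: compact_closedI => //; exact: open_subgroup_closed.
Qed.

Section StableEntropy.
Local Open Scope ring_scope.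
Variables (R : realType) (G : topologicalGroupType).
Variable mu : {measure set (borelType G) -> \bar R}.
Hypotheses (hausG : hausdorff_space G) (haar : right_haar_measure mu).
Variable phi : G -> G.
Hypothesis phi_aut : topological_automorphism phi.

Local Notation vol := (volume mu).
Local Notation co := (@compact_open_subgroup G).

Let phiM : {morph phi : x y / (x * y)%g}. Proof. by case: phi_aut. Qed.
Let phi_inj : injective phi.
Proof. by have [_ [psi [phiK _ _ _]]] := phi_aut; exact: can_inj phiK. Qed.

Lemma volume_mono (A B : set G) : co A -> co B -> A `<=` B -> vol A <= vol B.
Proof.
move=> coA coB AB; rewrite -lee_fin -!volumeE //.
have [[_ oA _] [_ oB _]] := (coA, coB).
by apply: le_measure => //; rewrite inE; exact: open_borel.
Qed.

(** The factor by which an automorphism scales the measure of nested compact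
    open subgroups is constant: [phi] carries cosets to cosets. *)
Lemma volume_automorphism (A B : set G) : co A -> co B -> A `<=` B ->
  vol (phi @` B) * vol A = vol B * vol (phi @` A).
Proof.
move=> coA coB AB; have [[sA oA _] [sB _ cB]] := (coA, coB).
have [I [r tr]] := transversal_exists sA oA cB.
have phiK (X : set G) : phi @^-1` (phi @` X) = X.
  by apply/seteqP; split=> [x [y Xy /phi_inj <-]|x Xx] //; exists x.
rewrite (volume_transversal haar coA coB AB tr).
rewrite -{1}(phiK A) in tr.
rewrite (volume_transversal haar _ _ _ (right_transversal_image phiM tr)).
- by ring.
- exact: automorphism_compact_open.
- exact: automorphism_compact_open.
- exact: image_subset.
Qed.

(** |AB : A| = |B : A `&` B| in terms of measures. *)
Lemma volume_mul (A B : set G) : co A -> co B -> co (mul_set A B) ->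
  vol (mul_set A B) * vol (A `&` B) = vol A * vol B.
Proof.
move=> coA coB coAB; have [[sA oA _] [sB _ cB]] := (coA, coB).
have coI := compact_open_subgroupI coA coB.
have [I [r tr]] := transversal_exists sA oA cB.
have [B1 _ _] := sB.
have := volume_transversal haar coA coAB (mul_set_subl B1)
  (right_transversal_mul sA tr).
have := volume_transversal haar coI coB (@subIsetr _ _ _)
  (right_transversalI sB tr).
by move=> -> ->; ring.
Qed.

(* The trajectories t n grow at a constant rate from the index n0 at which the
   increasing chain of the subgroups U `&` phi (t n) has become constant. *)
Variables (U : set G) (n0 : nat) (W : set G).
Hypotheses (coU : co U) (coW : co W).
Local Notation t n := (trajectory phi U n.+1).
Hypothesis sT : forall n, is_subgroup (t n).
Hypothesis stable : forall n, (n0 <= n)%N -> U `&` phi @` t n = W.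

Let coT n : co (t n).
Proof. exact: trajectory_compact_open. Qed.

(** As [t n.+1] is the product of [phi (t n)] and [U], which meet in [W],
    vol (t n.+1) vol W = vol (phi (t n)) vol U = vol (t n) vol (phi U). *)
Lemma stable_volume n : (n0 <= n)%N ->
  vol (t n.+1) = vol (phi @` U) / vol W * vol (t n).
Proof.
move=> n0n; have [[U1 _ _] _ _] := coU.
have cophiT := automorphism_compact_open phi_aut (coT n).
have tE : t n.+1 = mul_set (phi @` t n) U.
  have coTn := coT n.+1; rewrite trajectorySl // in coTn *.
  by apply: is_subgroup_mulC; [case: coU|case: cophiT|case: coTn].
have Ut : U `<=` t n by rewrite -{1}(trajectory1 phi U); exact: trajectory_le.
have := volume_mul cophiT coU; rewrite -tE setIC stable // => /(_ (coT _)) E1.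
have E2 := volume_automorphism coU (coT n) Ut.
apply: (mulIf (lt0r_neq0 (volume_gt0 hausG haar coW))).
rewrite E1 E2; field.
exact: lt0r_neq0 (volume_gt0 hausG haar coW).
Qed.

Lemma stable_ratio_ge1 : 1 <= vol (phi @` U) / vol W.
Proof.
have v0 := volume_gt0 hausG haar (coT n0).
have U1 : U 1%g by case: coU => -[].
have := volume_mono (coT n0) (coT n0.+1) (@trajectory_subS _ _ phiM _ _ U1).
by rewrite stable_volume // -{1}[vol (t n0)]mul1r ler_pM2r.
Qed.

(** The limit superior in the definition of the entropy is a limit, the
    volumes of the trajectories being eventually geometric. *)
Lemma stable_entropy :
  algebraic_entropy_nbhs mu phi U = (ln (vol (phi @` U) / vol W))%:E.
Proof.
set c := _ / _; have c0 : 0 < c := lt_le_trans ltr01 stable_ratio_ge1.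
rewrite /algebraic_entropy_nbhs; apply: (cvg_limn_einf_sup _).2.
have cv : (fun n => n%:R^-1 * ln (vol (trajectory phi U n))) @ \oo --> ln c.
  apply: (@cvg_ln_geometric _ _ _ n0.+1) => //.
    exact: volume_gt0 (coT _).
  by case=> // n; exact: stable_volume.
rewrite -(cvg_shiftn 1) in cv; rewrite -(cvg_shiftn 1).
have -> : [sequence ((n + 1)%:R^-1)%:E *
    lne (mu (trajectory phi U (n + 1)%N))]_n%E =
    EFin \o [sequence (n + 1)%:R^-1 * ln (vol (trajectory phi U (n + 1)%N))]_n.
  apply/funext => n /=; rewrite addn1 (volumeE haar (coT n)) lne_EFin //.
  exact: volume_gt0 (coT _).
exact: cvg_comp cv _.
Qed.

End StableEntropy.

(** * Transfer to closed subgroups and quotients *)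

Lemma closed1_hausdorff (G : topologicalGroupType) :
  closed [set (1 : G)] -> hausdorff_space G.
Proof.
move=> cl1 p q clpq; apply: contrapT => pq.
have oO : open (~` [set (1 : G)]) by exact: closed_openC.
have Opq : nbhs (p^-1 * q) (~` [set (1 : G)]).
  apply: open_nbhs_nbhs; split=> // /= pq1; apply: pq.
  by apply: (@mulgI _ p^-1); rewrite mulVg pq1.
have [[A B] /= [nA nB] AB] := @mulg_continuous G (p^-1, q) _ Opq.
have nA' : nbhs p ((fun x => x^-1) @^-1` A) by exact: invg_continuous nA.
have [z [/= Az Bz]] := clpq _ _ nA' nB.
by have := AB (z^-1, z) (conj Az Bz); rewrite /= mulVg; apply.
Qed.

Section Subgroup.
Variables (G : topologicalGroupType) (H : subgroup G).
Local Notation HT := (subgroup_type H).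
Local Notation v := (val : HT -> G).

Lemma subgroup_range (x : G) : (H : set G) x -> exists y : HT, v y = x.
Proof. by move=> Hx; exists (exist _ x (mem_set Hx)). Qed.

Lemma subgroup_valP (x : HT) : (H : set G) (v x).
Proof. exact: set_mem (valP x). Qed.

Lemma image_preimage_val (A : set G) : v @` (v @^-1` A) = A `&` H.
Proof.
apply/seteqP; split=> [_ [x Ax <-]|x [Ax Hx]].
  by split=> //; exact: subgroup_valP.
by have [y yx] := subgroup_range Hx; exists y => //=; rewrite yx.
Qed.

Lemma preimage_image_val (A : set HT) : v @^-1` (v @` A) = A.
Proof. by apply/seteqP; split=> [x [y Ay /val_inj <-]|x Ax] //; exists x. Qed.

Lemma subgroup_hausdorff : hausdorff_space G -> hausdorff_space HT.
Proof.
move=> hausG p q clpq; apply: val_inj; apply: hausG => A B nA nB.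
have [z [Az Bz]] := clpq _ _ (@subgroup_val_continuous G H p _ nA)
  (@subgroup_val_continuous G H q _ nB).
by exists (v z).
Qed.

(** The subgroup carries the initial topology, so a cluster point in [G] of
    the image filter that lies in [H] is a cluster point in the subgroup. *)
Lemma compact_preimage_val (A : set G) :
  closed (H : set G) -> compact A -> compact (v @^-1` A).
Proof.
move=> clH cA F PF FA; have cAH := compact_closedI cA clH.
have FAH : F (v @^-1` (A `&` H)).
  apply: (@filterS _ F _ (v @^-1` A)) => // x Ax.
  by split=> //; exact: subgroup_valP.
have [p [[Ap /subgroup_range [q qp]] clq]] := cAH (v @ F) _ FAH.
exists q; rewrite -qp in Ap clq; split=> // B C FB nC.
have [C' [[C'' oC'' <-] C''q C''C]] : exists C', [/\ open C', C' q & C' `<=` C].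
  by move: nC; rewrite nbhsE => -[C' [? ?] ?]; exists C'.
have [_ [[z Bz <-] C''z]] : v @` B `&` C'' !=set0.
  apply: clq; last exact: open_nbhs_nbhs.
  by apply: (@filterS _ F _ B) => // x Bx; exists x.
by exists z; split=> //; exact: C''C.
Qed.

Lemma compact_open_preimage_val (A : set G) : closed (H : set G) ->
  compact_open_subgroup A -> compact_open_subgroup (v @^-1` A).
Proof.
move=> clH [sA oA cA]; split; last exact: compact_preimage_val.
- exact: is_subgroup_preimage (@subgroup_valM G H) _ sA.
- by move/continuousP: (@subgroup_val_continuous G H); exact.
Qed.

Lemma compact_subgroup_image_val (A : set HT) :
  compact_subgroup A -> compact_subgroup (v @` A).
Proof.
move=> [sA cA]; split; first exact: is_subgroup_image (@subgroup_valM G H) _ sA.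
apply: continuous_compact_image => //; exact: subgroup_val_continuous.
Qed.

End Subgroup.

Section Quotient.
Local Open Scope quotient_scope.
Variables (G : topologicalGroupType) (H : normal_subgroup G).
Local Notation Q := (quotient_group H).
Local Notation p := (\pi_(Q) : G -> Q).

Lemma pi_morph : {morph p : x y / x * y}.
Proof. exact: quotient_piM. Qed.

Lemma quotient_hausdorff : closed (H : set G) -> hausdorff_space Q.
Proof.
move=> clH; apply: closed1_hausdorff; rewrite -[X in closed X]setCK.
apply: open_closedC; rewrite /open /= /quotient_open.
rewrite (_ : _ @^-1` _ = ~` (H : set G)); first exact: closed_openC.
apply/seteqP; split=> x /=; apply: contra_not.
  move=> Hx; apply/esym/eqP.
  by rewrite -(morph1 pi_morph) eq_coset invg1 mul1g mem_set.
move=> /esym/eqP; rewrite -(morph1 pi_morph) eq_coset invg1 mul1g.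
exact: set_mem.
Qed.

Lemma compact_image_pi (A : set G) : compact A -> compact (p @` A).
Proof.
move=> cA; apply: continuous_compact_image => //.
exact: quotient_pi_continuous.
Qed.

Lemma compact_open_image_pi (A : set G) :
  compact_open_subgroup A -> compact_open_subgroup (p @` A).
Proof.
move=> [sA oA cA]; split.
- exact: is_subgroup_image pi_morph _ sA.
- exact: quotient_pi_open.
- exact: compact_image_pi.
Qed.

Lemma preimage_image_pi (A : set G) : p @^-1` (p @` A) = mul_set A H.
Proof.
apply/seteqP; split=> [x [a Aa /eqP]|_ [a Aa [h Hh <-]]].
  rewrite eq_coset => /set_mem Hx.
  by exists a => //; exists (a^-1 * x) => //; rewrite mulgA mulgV mul1g.
by exists a => //; apply/eqP; rewrite eq_coset mulKg mem_set.
Qed.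

(** Cover [C] by translates of the image of a compact neighborhood [W] of 1, and
    lift the finitely many translating elements. *)
Lemma quotient_compact_lift (C : set Q) : locally_compact [set: G] ->
  compact C -> exists2 D, compact D & C `<=` p @` D.
Proof.
move=> lcG cC; have [W nW cW] := locally_compact_nbhs1 lcG.
have [|F [_ CF]] :=
  compact_translates cC (quotient_pi_open H (@open_interior _ W)).
  by exists 1 => //; exact: morph1 pi_morph.
exists (mul_set W (repr @` [set` F])).
  apply: compact_mul_set => //; apply: finite_compact; apply: finite_image.
  exact: finite_fset.
move=> x /CF [_ [w /interior_subset Ww <-] [q Fq <-]].
exists (w * repr q).
  by exists w => //; exists (repr q) => //; exists q.
by rewrite pi_morph reprK.
Qed.

End Quotient.

Section InducedAutomorphisms.
Local Open Scope quotient_scope.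
Variables (G : topologicalGroupType) (phi : G -> G).
Hypothesis phi_aut : topological_automorphism phi.

Lemma subgroup_map_automorphism (H : subgroup G) (phiH : phi @` H = H) :
  topological_automorphism (subgroup_map phiH).
Proof.
have [phiM [psi [phiK psiK cphi cpsi]]] := phi_aut; split.
  move=> x y; apply: val_inj.
  by rewrite subgroup_mapE !subgroup_valM phiM.
have psiH : psi @` H = H.
  rewrite -[in LHS]phiH image_comp; apply/seteqP.
  by split=> [_ [x Hx <-]|x Hx]; [|exists x]; rewrite //= phiK.
exists (subgroup_map psiH); split.
- by move=> x; apply: val_inj; rewrite !subgroup_mapE phiK.
- by move=> x; apply: val_inj; rewrite !subgroup_mapE psiK.
- apply: subgroup_continuous => x.
  apply: (@continuous_comp _ _ _ (val : subgroup_type H -> G) phi).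
    exact: subgroup_val_continuous.
  exact: cphi.
- apply: subgroup_continuous => x.
  apply: (@continuous_comp _ _ _ (val : subgroup_type H -> G) psi).
    exact: subgroup_val_continuous.
  exact: cpsi.
Qed.

Lemma quotient_map_automorphism (H : normal_subgroup G) :
  phi @` H = H -> topological_automorphism (quotient_map (N := H) phi).
Proof.
have [phiM [psi [phiK psiK cphi cpsi]]] := phi_aut => phiH.
have psiM : {morph psi : x y / x * y}.
  by move=> x y; rewrite -{1}(psiK x) -{1}(psiK y) -phiM phiK.
have psiH : psi @` H = H.
  rewrite -[in LHS]phiH image_comp; apply/seteqP.
  by split=> [_ [x Hx <-]|x Hx]; [|exists x]; rewrite //= phiK.
have cont f : {morph f : x y / x * y} -> f @` H = H -> continuous f ->
    continuous (quotient_map (N := H) f).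
  move=> fM fH cf; apply/quotient_continuous => x.
  rewrite (_ : _ \o _ = \pi_(quotient_group H) \o f); last first.
    by apply/funext => y /=; rewrite quotient_mapE.
  by apply: continuous_comp; [exact: cf|exact: quotient_pi_continuous].
split.
  move=> x y; rewrite -[x]reprK -[y]reprK -pi_morph !quotient_mapE //.
  by rewrite phiM pi_morph.
exists (quotient_map psi); split; [| |exact: cont|exact: cont].
- move=> x; rewrite -[x]reprK (quotient_mapE phiM phiH).
  by rewrite (quotient_mapE psiM psiH) phiK.
- move=> x; rewrite -[x]reprK (quotient_mapE psiM psiH).
  by rewrite (quotient_mapE phiM phiH) psiK.
Qed.

End InducedAutomorphisms.

(** * Stabilisation of trajectories *)

Section Stabilisation.
Variables (G : topologicalGroupType) (phi : G -> G).
Hypothesis phi_aut : topological_automorphism phi.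
Variable U : set G.
Hypothesis coU : compact_open_subgroup U.
Local Notation t n := (trajectory phi U n.+1).
Hypothesis sT : forall n, is_subgroup (t n).

Lemma stable_compact_open n : compact_open_subgroup (U `&` phi @` t n).
Proof.
apply: compact_open_subgroupI => //; apply: automorphism_compact_open => //.
exact: trajectory_compact_open.
Qed.

Lemma stable_exists : exists n0, forall n, (n0 <= n)%N ->
  U `&` phi @` t n = U `&` phi @` t n0.
Proof.
have [phiM _] := phi_aut; have [[U1 _ _] _ cU] := coU.
apply: (compact_increasing_stable cU (W := fun n => U `&` phi @` t n)).
- by move=> n; have [] := stable_compact_open n.
- by move=> n; have [] := stable_compact_open n.
- by move=> m n mn; apply: setIS; apply: image_subset; exact: trajectory_le.
- by move=> n x [].
Qed.

(** If [u z = x] with [u] in [U] and both [z], [x] in [phi (t k)], then [u] is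
    in [U `&` phi (t k)], which by stability is already in [phi (t n0)].
    Unlike a statement about indices, this inclusion survives intersection with
    a subgroup. *)
Lemma stable_trajectoryI n0 :
  (forall n, (n0 <= n)%N -> U `&` phi @` t n = U `&` phi @` t n0) ->
  forall k, (n0 <= k)%N -> t n0.+1 `&` phi @` t k `<=` phi @` t n0.
Proof.
move=> stable k n0k x [+ tkx]; have [phiM _] := phi_aut.
have [[U1 _ _] _ _] := coU.
have [_ tkM tkV] := is_subgroup_image phiM (sT k).
have [_ tM _] := is_subgroup_image phiM (sT n0).
rewrite trajectorySl // => -[u Uu [z tz uz]].
have tkz : (phi @` t k) z by move: z tz {uz}; apply: image_subset; exact: trajectory_le.
have tku : (phi @` t k) u.
  by rewrite -(mulgK z u) uz; apply: (tkM) => //; exact: tkV.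
have : (U `&` phi @` t k) u by [].
by rewrite stable // => -[_ tu]; rewrite -uz; exact: tM.
Qed.

End Stabilisation.

(** * Finiteness and monotonicity *)

Section Entropy.
Local Open Scope ring_scope.
Local Open Scope ereal_scope.
Variables (R : realType) (G : topologicalGroupType).
Variable mu : {measure set (borelType G) -> \bar R}.
Hypotheses (hausG : hausdorff_space G) (haar : right_haar_measure mu).
Variable phi : G -> G.
Hypothesis phi_aut : topological_automorphism phi.

Lemma entropy_compact_open (U : set G) : compact_open_subgroup U ->
  (forall n, is_subgroup (trajectory phi U n.+1)) ->
  algebraic_entropy_nbhs mu phi U \is a fin_num.
Proof.
move=> coU sT; have [n0 stable] := stable_exists phi_aut coU sT.
have coW := stable_compact_open phi_aut coU sT n0.
by rewrite (stable_entropy hausG haar phi_aut coU coW sT stable).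
Qed.

Lemma algebraic_entropy_nbhs_mono (U V : set G) : compact U -> compact V ->
  U `<=` V -> algebraic_entropy_nbhs mu phi U <= algebraic_entropy_nbhs mu phi V.
Proof.
move=> cU cV UV; have [phiM [_ [_ _ cphi _]]] := phi_aut.
apply: le_ereal_inf_tmp => _ [F nF <-].
apply: (@le_trans _ _ (ereal_sup
    ((fun n => (n%:R^-1)%:E * lne (mu (trajectory phi U n))) @` F))).
  by apply: ereal_inf_lbound; exists F.
apply: ge_ereal_sup => _ [n Fn <-].
apply: le_ereal_sup_tmp; exists ((n%:R^-1)%:E * lne (mu (trajectory phi V n))).
  by exists n.
apply: lee_wpmul2l; first by rewrite lee_fin invr_ge0.
have cT (W : set G) :
    compact W -> measurable (trajectory phi W n : set (borelType G)).
  by move=> cW; apply: compact_borel => //; exact: compact_trajectory.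
rewrite lee_lne ?in_itv /= ?measure_ge0 ?leey //.
by apply: le_measure; rewrite ?inE; [exact: cT|exact: cT|exact: trajectoryS].
Qed.

End Entropy.

(** Finite elements of [Y] can be moved across the inequality, which gives the
    bound for the supremum of [X] first, whether that supremum is finite or not. *)
Lemma ereal_sup_add_le (R : realType) (X Y : set \bar R) z :
  Y !=set0 ->
  (forall y, Y y -> y \is a fin_num) -> (forall x y, X x -> Y y -> x + y <= z)%E ->
  (ereal_sup X + ereal_sup Y <= z)%E.
Proof.
move=> [y0 Yy0] Yfin XYz.
have XY y : Y y -> (ereal_sup X + y <= z)%E.
  move=> Yy; rewrite -leeBrDr ?Yfin //; apply: ge_ereal_sup => x Xx.
  by rewrite leeBrDr ?Yfin //; exact: XYz.
have [| |] := ltgtP (ereal_sup X) +oo%E.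
- move=> Xoo; case: (ereal_sup X) Xoo XY => [r _ XY|//|_ _].
    rewrite addeC -leeBrDr //; apply: ge_ereal_sup => y Yy.
    by rewrite leeBrDr // addeC; exact: XY.
  by rewrite addNye leNye.
- by rewrite ltNge leey.
- move=> XE; have := XY y0 Yy0; rewrite XE addye; last first.
    by have := Yfin _ Yy0; rewrite fin_numE => /andP[].
  by rewrite leye_eq => /eqP ->; rewrite leey.
Qed.

(** * The addition formula *)

Section Addition.
Local Open Scope ring_scope.
Local Open Scope quotient_scope.
Variables (R : realType) (G : topologicalGroupType).
Hypotheses (hausG : hausdorff_space G) (tqhG : topologically_quasihamiltonian G).
Variable H : normal_subgroup G.
Hypothesis closedH : closed (H : set G).
Variables (muG : {measure set (borelType G) -> \bar R})
  (muH : {measure set (borelType (subgroup_type H)) -> \bar R})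
  (muGH : {measure set (borelType (quotient_group H)) -> \bar R}).
Hypotheses (haarG : right_haar_measure muG) (haarH : right_haar_measure muH)
  (haarGH : right_haar_measure muGH).

Local Notation Q := (quotient_group H).
Local Notation HT := (subgroup_type H).
Local Notation p := (\pi_(Q) : G -> Q).
Local Notation v := (val : HT -> G).
Local Notation co := compact_open_subgroup.

Let hausQ := quotient_hausdorff closedH.
Let hausH := @subgroup_hausdorff G H hausG.

(** |B : A| = |BH/H : AH/H| |B `&` H : A `&` H|, written with measures and
    without denominators. *)
Lemma volume_extension (A B : set G) : co A -> co B -> A `<=` B ->
  volume muG B * (volume muGH (p @` A) * volume muH (v @^-1` A)) =
  volume muG A * (volume muGH (p @` B) * volume muH (v @^-1` B)).
Proof.
move=> coA coB AB.
have coA' := compact_open_preimage_val closedH coA.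
have coB' := compact_open_preimage_val closedH coB.
have [[sA oA _] [sB _ cB]] := (coA, coB).
have [[sA' oA' _] [_ _ cB']] := (coA', coB').
have [I [r tr]] : exists (I : finType) (r : I -> G),
    right_transversal (mul_set A H) B r.
  apply: transversal_exists => //; last exact: open_mul_set.
  rewrite -preimage_image_pi; apply: is_subgroup_preimage (@pi_morph _ _) _ _.
  exact: is_subgroup_image (@pi_morph _ _) _ sA.
have [J [s ts]] : exists (J : finType) (s : J -> HT),
    right_transversal (v @^-1` A) (v @^-1` B) s.
  exact: transversal_exists.
have tsG := right_transversal_image (@subgroup_valM G H) ts.
rewrite image_preimage_val in tsG.
have trs :=
  right_transversal_extension sA sB (subgroup_is_subgroup H) AB tr tsG.
rewrite -preimage_image_pi in tr.
have trQ := right_transversal_image (@pi_morph G H) tr.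
rewrite (volume_transversal haarG coA coB AB trs) card_prod natrM.
rewrite (volume_transversal haarH coA' coB' _ ts); last by move=> x; exact: AB.
rewrite (volume_transversal haarGH _ _ _ trQ); first by ring.
- exact: compact_open_image_pi.
- exact: compact_open_image_pi.
- exact: image_subset.
Qed.

Variable phi : G -> G.
Hypotheses (phi_aut : topological_automorphism phi) (phiH : phi @` H = H).
Let phiM : {morph phi : x y / (x * y)%g}. Proof. by case: phi_aut. Qed.
Let phi_inj : injective phi.
Proof. by have [_ [psi [phiK _ _ _]]] := phi_aut; exact: can_inj phiK. Qed.

Local Notation phiQ := (quotient_map (N := H) phi).
Local Notation phi_H := (subgroup_map phiH).

Lemma trajectory_is_subgroup (U : set G) n : compact_subgroup U ->
  is_subgroup (trajectory phi U n).
Proof.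
move=> csU; have [_ [_ [_ _ cphi _]]] := phi_aut.
by have [] := trajectory_compact_subgroup phiM n hausG tqhG cphi csU.
Qed.

Lemma quotient_trajectoryE (U : set G) n :
  p @` trajectory phi U n = trajectory phiQ (p @` U) n.
Proof.
apply: image_trajectory (@pi_morph G H) _ => x.
by rewrite (quotient_mapE phiM phiH).
Qed.

Lemma subgroup_trajectoryE (V : set HT) n :
  v @` trajectory phi_H V n = trajectory phi (v @` V) n.
Proof. exact: image_trajectory (@subgroup_valM G H) _. Qed.

Lemma quotient_trajectory_is_subgroup (U : set G) n : compact_subgroup U ->
  is_subgroup (trajectory phiQ (p @` U) n).
Proof.
move=> csU; rewrite -quotient_trajectoryE.
exact: is_subgroup_image (@pi_morph _ _) _ (trajectory_is_subgroup n csU).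
Qed.

Lemma subgroup_trajectory_is_subgroup (V : set HT) n : compact_subgroup V ->
  is_subgroup (trajectory phi_H V n).
Proof.
move=> csV; rewrite -[trajectory _ _ _]preimage_image_val subgroup_trajectoryE.
apply: is_subgroup_preimage (@subgroup_valM _ _) _ _.
exact: trajectory_is_subgroup (compact_subgroup_image_val csV).
Qed.

(** Comparing trajectories of [t m] with those of [U] bounds the growth inside
    [H] of the subgroups [t m `&` H], which are not trajectories themselves. *)
Lemma trajectory_trajectory_sub (U : set G) m k : compact_subgroup U ->
  trajectory phi (trajectory phi U m.+1) k.+1 `<=` trajectory phi U (m + k).+1.
Proof.
move=> csU; have [[U1 _ _] _] := csU.
elim: k => [|k IH]; first by rewrite trajectory1 addn0.
rewrite trajectorySl // => _ [x tx [_ [y /IH ty <-] <-]].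
have [_ tM _] := trajectory_is_subgroup (m + k.+1).+1 csU; apply: tM.
  by move: x tx; apply: trajectory_le => //; rewrite ltnS leq_addr.
by rewrite addnS; apply: image_trajectory_sub => //; exists y.
Qed.

Lemma compact_open_compact_subgroup (G' : topologicalGroupType) (U : set G') :
  co U -> compact_subgroup U.
Proof. by case. Qed.

(** The subgroup [U' := t n0.+1], with [n0] a common stabilisation index for [U]
    and its image in the quotient, absorbs the discrepancy between
    [t n `&` H] and the trajectories inside [H]: writing [V] for [U' `&` H], the
    intersections [V `&` phi (trajectory of V)] all equal [phi (t n0 `&` H)], by
    [stable_trajectoryI].  Hence the trajectories of [V] grow at the rate
    vol V / vol (t n0 `&` H), which by [volume_extension] is the quotient of the
    growth rates of [U] in [G] and of its image in the quotient group. *)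
Lemma entropy_addition (U : set G) : co U -> exists2 U', co U' /\ U `<=` U' &
  algebraic_entropy_nbhs muG phi U =
  (algebraic_entropy_nbhs muGH phiQ (p @` U) +
   algebraic_entropy_nbhs muH phi_H (v @^-1` U'))%E.
Proof.
move=> coU; have csU := compact_open_compact_subgroup coU.
have [[U1 _ _] _] := csU.
have autQ := quotient_map_automorphism phi_aut phiH.
have autH := subgroup_map_automorphism phi_aut phiH.
have coQ := compact_open_image_pi H coU.
pose t n := trajectory phi U n.+1.
have sT n : is_subgroup (t n) := trajectory_is_subgroup n.+1 csU.
have sTQ n := quotient_trajectory_is_subgroup n.+1 csU.
have [nG stG] := stable_exists phi_aut coU sT.
have [nQ stQ] := stable_exists autQ coQ sTQ.
pose n0 := maxn nG nQ.
have stG0 n : (n0 <= n)%N -> U `&` phi @` t n = U `&` phi @` t n0.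
  move=> n0n; rewrite /t stG; last exact: leq_trans (leq_maxl _ _) n0n.
  by rewrite (stG n0) //; exact: leq_maxl.
have coT n : co (t n) := trajectory_compact_open phi_aut coU (sT n).
have coS n := compact_open_preimage_val closedH (coT n).
(* W is the constant value of the intersections V `&` phi (trajectory of V) *)
pose U' := t n0.+1; pose V := v @^-1` U'; pose W := phi_H @` (v @^-1` t n0).
have csV := compact_open_compact_subgroup (coS n0.+1).
have sTH n := subgroup_trajectory_is_subgroup n.+1 csV.
have coW : co W := automorphism_compact_open autH (coS n0).
have stH k : (0 <= k)%N -> V `&` phi_H @` trajectory phi_H V k.+1 = W.
  move=> _; apply/seteqP; split.
    move=> x [Vx [y ty yx]]; rewrite -yx in Vx *.
    have tky : t (n0.+1 + k)%N (v y).
      apply: trajectory_trajectory_sub => //.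
      have : trajectory phi (v @` V) k.+1 (v y).
        by rewrite -subgroup_trajectoryE; exists y.
      apply: trajectoryS => _ [z Vz <-]; exact: Vz.
    have [z tz zy] : (phi @` t n0) (v (phi_H y)).
      apply: (@stable_trajectoryI _ _ phi_aut _ coU sT n0 stG0 (n0.+1 + k)%N).
        by rewrite addSn ltnW // ltnS leq_addr.
      by split=> //; exists (v y).
    by exists y => //=; rewrite -(phi_inj zy).
  move=> _ [z tz <-]; split.
    by apply: image_trajectory_sub => //; exists (v z).
  exists z => //.
  suff : trajectory phi_H V 1 `<=` trajectory phi_H V k.+1.
    apply; rewrite trajectory1; exact: trajectory_subS tz.
  apply: trajectory_le => //; first by case: autH.
  by case: csV => -[].
exists U'.
  split; first exact: coT.
  by move=> x Ux; apply: (trajectory_le phiM U1 (ltn0Sn _)); rewrite trajectory1.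
have eG := stable_entropy hausG haarG phi_aut coU
  (stable_compact_open phi_aut coU sT nG) sT stG.
have eQ := stable_entropy hausQ haarGH autQ coQ
  (stable_compact_open autQ coQ sTQ nQ) sTQ stQ.
have eH := stable_entropy hausH haarH autH (coS n0.+1) coW sTH stH.
have c1G := stable_ratio_ge1 hausG haarG phi_aut coU
  (stable_compact_open phi_aut coU sT nG) sT stG.
have c1Q := stable_ratio_ge1 hausQ haarGH autQ coQ
  (stable_compact_open autQ coQ sTQ nQ) sTQ stQ.
have c1H := stable_ratio_ge1 hausH haarH autH (coS n0.+1) coW sTH stH.
have vG := stable_volume hausG haarG phi_aut coU
  (stable_compact_open phi_aut coU sT nG) sT stG (leq_maxl nG nQ).
have vQ := stable_volume hausQ haarGH autQ coQ
  (stable_compact_open autQ coQ sTQ nQ) sTQ stQ (leq_maxr nG nQ).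
have vH := volume_automorphism haarH autH (coS n0) (coS n0.+1)
  (fun x => @trajectory_subS _ _ phiM U n0.+1 U1 (v x)).
set cG := volume muG (phi @` U) / _ in eG c1G vG.
set cQ := volume muGH (phiQ @` _) / _ in eQ c1Q vQ.
rewrite -[maxn nG nQ]/n0 -!quotient_trajectoryE in vG vQ.
have ext := volume_extension (coT n0) (coT n0.+1)
  (@trajectory_subS _ _ phiM U n0.+1 U1).
rewrite -/W -/V in vH.
rewrite eG eQ eH -EFinD -lnM ?posrE; try exact: lt_le_trans ltr01 _.
congr (ln _)%:E.
move: vG vQ vH ext; rewrite -!/(t _) -/U' -/V -/W.
move=> vG vQ vH; rewrite vG vQ.
have v0 := volume_gt0 hausG haarG (coT n0).
have q0 := volume_gt0 hausQ haarGH (compact_open_image_pi H (coT n0)).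
have h0 := volume_gt0 hausH haarH (coS n0).
have w0 := volume_gt0 hausH haarH coW.
move=> ext; apply: (mulIf (lt0r_neq0 (mulr_gt0 v0 (mulr_gt0 q0 h0)))).
have -> : volume muH (phi_H @` V) / volume muH W =
    volume muH V / volume muH (v @^-1` t n0).
  apply/eqP; rewrite eqr_div ?lt0r_neq0 //; exact/eqP.
apply: etrans (etrans _ ext) _; first exact: mulrA.
by field; exact: lt0r_neq0.
Qed.

End Addition.

Unset Implicit Arguments.
Local Close Scope group_scope.
Local Open Scope ring_scope.
Local Open Scope ereal_scope.

Theorem corollary5p5 (R : realType) (G : topologicalGroupType)
    (hausG : hausdorff_space G) (lcG : locally_compact [set: G])
    (ccG : compactly_covered G) (tqhG : topologically_quasihamiltonian G)
    (phi : G -> G) (phi_aut : topological_automorphism phi)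
    (H : normal_subgroup G) (closedH : closed (H : set G))
    (phiH : phi @` H = H)
    (muG : {measure set (borelType G) -> \bar R})
    (muH : {measure set (borelType (subgroup_type H)) -> \bar R})
    (muGH : {measure set (borelType (quotient_group H)) -> \bar R})
    (haarG : right_haar_measure muG)
    (haarH : right_haar_measure muH)
    (haarGH : right_haar_measure muGH) :
  algebraic_entropy muG phi =
    algebraic_entropy muGH (quotient_map phi) +
    algebraic_entropy muH (subgroup_map phiH).
Proof.
have hausQ := quotient_hausdorff closedH.
have hausH := @subgroup_hausdorff G H hausG.
have autQ := quotient_map_automorphism phi_aut phiH.
have autH := subgroup_map_automorphism phi_aut phiH.
have addition U (coU : compact_open_subgroup U) := entropy_addition hausG tqhG
  closedH haarG haarH haarGH phi_aut phiH coU.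
have co_nbhs (G' : topologicalGroupType) (U : set G') :
    compact_open_subgroup U -> compact U /\ nbhs (1%g : G') U.
  by move=> [[U1 _ _] oU cU]; split=> //; exact: open_nbhs_nbhs.
have le_sup (G' : topologicalGroupType)
    (mu : {measure set (borelType G') -> \bar R}) (f : G' -> G') (U : set G') :
    compact_open_subgroup U ->
    algebraic_entropy_nbhs mu f U <= algebraic_entropy mu f.
  by move=> /co_nbhs coU; apply: ereal_sup_ubound; exists U.
apply/eqP; rewrite eq_le; apply/andP; split.
  apply: ge_ereal_sup => _ [C [cC _] <-].
  have [U coU CU] := compact_sub_compact_open hausG lcG ccG tqhG cC.
  have [U' [coU' _] eU] := addition U coU.
  apply: (@le_trans _ _ (algebraic_entropy_nbhs muG phi U)).
    by apply: algebraic_entropy_nbhs_mono => //; case: coU.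
  rewrite eU; apply: leeD; apply: le_sup; first exact: compact_open_image_pi.
  exact: compact_open_preimage_val.
(* The supremum over H is taken over traces of compact open subgroups of G, at
   which the entropy is finite, as [ereal_sup_add_le] requires. *)
pose hH U := algebraic_entropy_nbhs muH (subgroup_map phiH) (val @^-1` U).
have hHE : algebraic_entropy muH (subgroup_map phiH) <=
    ereal_sup [set hH U | U in @compact_open_subgroup G].
  apply: ge_ereal_sup => _ [C [cC _] <-].
  have cvC : compact (val @` C : set G).
    apply: continuous_compact_image => //; exact: subgroup_val_continuous.
  have [U coU CU] := compact_sub_compact_open hausG lcG ccG tqhG cvC.
  apply: le_ereal_sup_tmp; exists (hH U); first by exists U.
  apply: algebraic_entropy_nbhs_mono => //.
    by case: (compact_open_preimage_val closedH coU).
  by move=> x Cx; apply: CU; exists x.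
apply: le_trans (leeD (lexx _) hHE) _; apply: ereal_sup_add_le.
- have [U coU _] := compact_sub_compact_open hausG lcG ccG tqhG (@compact0 G).
  by exists (hH U), U.
- move=> _ [U coU <-]; have coV := compact_open_preimage_val closedH coU.
  apply: entropy_compact_open => // n.
  apply: subgroup_trajectory_is_subgroup => //.
  exact: compact_open_compact_subgroup.
- move=> _ _ [C [cC _] <-] [U coU <-].
  have [D cD CD] := quotient_compact_lift lcG cC.
  have [_ _ cU] := coU.
  (* V serves both C and U; passing from V to V' only enlarges the second
     summand, so the entropy relative to V dominates the sum. *)
  have [V coV DUV] := compact_sub_compact_open hausG lcG ccG tqhG (compactU cD cU).
  have [V' [coV' VV'] eV] := addition V coV.
  apply: le_trans (le_sup _ muG phi V coV); rewrite eV; apply: leeD.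
    apply: algebraic_entropy_nbhs_mono => //.
      by case: (compact_open_image_pi H coV).
    by apply: subset_trans CD _; apply: image_subset => x Dx; apply: DUV; left.
  apply: algebraic_entropy_nbhs_mono => //.
  + by case: (compact_open_preimage_val closedH coU).
  + by case: (compact_open_preimage_val closedH coV').
  + by move=> x Ux; apply: VV'; apply: DUV; right.
Qed.
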